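(* Let $n\ge 4$ and $4\le k\le 2n-1$ be integers. Then $$\kappa^s(B_n;C_k)=\begin{cases}\dfrac{2n-2}{k}, & \text{if } 4\le k\le n-1 \text{ and } k\mid n-1,\\[2mm] \left\lceil\dfrac{2n-1}{k}\right\rceil, & \text{otherwise.}\end{cases}$$
   Context: All graphs are finite and simple. $C_k$ is the cycle with $k$ vertices. Structure connectivity. For a set $\mathcal{F}$ of subgraphs of a connected graph $G$ (no disjointness is required), let $V(\mathcal{F})$ be the union of the vertex sets of its members and $G-\mathcal{F}=G-V(\mathcal{F})$. $\mathcal{F}$ is a subgraph cut of $G$ if $G-\mathcal{F}$ is disconnected or is a trivial graph (a single vertex). For a connected graph $H$, an $H$-substructure cut is a subgraph cut each of whose members is isomorphic to a connected subgraph of $H$. $\kappa^s(G;H)$ is the minimum cardinality of an $H$-substructure cut of $G$. Crossed cube. Two binary strings $x_1x_0$, $y_1y_0$ are pair related, $x_1x_0\sim y_1y_0$, iff $(x_1x_0,y_1y_0)\in\{(00,00),(10,10),(01,11),(11,01)\}$. $CQ_1=K_2$ with vertices $0,1$. For $n\ge 2$, $CQ_n$ consists of two copies $CQ_{n-1}^0,CQ_{n-1}^1$ of $CQ_{n-1}$ (labels prefixed by $0$ and $1$ respectively), together with an edge between $u=0u_{n-2}\cdots u_0$ and $v=1v_{n-2}\cdots v_0$ iff $u_{n-2}=v_{n-2}$ when $n$ is even, and $u_{2i+1}u_{2i}\sim v_{2i+1}v_{2i}$ for all $0\le i<\lfloor\frac{n-1}{2}\rfloor$. BCDC network. $B_2$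 is the $4$-cycle with vertices $[00,01],[00,10],[01,11],[10,11]$ (two of these being adjacent iff they share an entry). For $n\ge 3$, $B_{n-1}^0$ (resp. $B_{n-1}^1$) is the copy of $B_{n-1}$ obtained by prefixing both entries of each vertex $[x,y]$ with $0$ (resp. $1$), and $B_n$ consists of $B_{n-1}^0$, $B_{n-1}^1$ and the independent set $S_n=\{[a,b]: a\in V(CQ_{n-1}^0), b\in V(CQ_{n-1}^1), (a,b)\in E(CQ_n)\}$, where $[a,b]\in V(B_{n-1}^0)$ is adjacent to $[c,d]\in S_n$ iff $a=c$ or $b=c$, and $[c,d]\in S_n$ is adjacent to $[e,f]\in V(B_{n-1}^1)$ iff $e=d$ or $f=d$ (there are no edges between $B_{n-1}^0$ and $B_{n-1}^1$). Equivalently, $B_n$ is the line graph of $CQ_n$. *)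

(* Defs.v *)
From mathcomp Require Import all_boot.

Set Implicit Arguments.
Unset Strict Implicit.
Unset Printing Implicit Defensive.

Structure sgraph := SGraph {
  vertex :> finType;
  adj : rel vertex;
  adj_sym : symmetric adj;
  adj_irrefl : irreflexive adj
}.

(* A (candidate) subgraph is a vertex set together with a set of edges, an
   edge being an unordered pair {x, y}. *)
Definition subgraph (G : sgraph) := ({set G} * {set {set G}})%type.

Section Subgraphs.
Variable G : sgraph.
Implicit Types (S : subgraph G) (W : {set G}) (F : {set subgraph G}).

Definition is_subgraph S : Prop :=
  forall A, A \in S.2 ->
    exists x y, [/\ x \in S.1, y \in S.1, adj x y & A = [set x; y]].

Definition induced W : subgraph G :=
  (W, [set [set x; y] | x in W, y in W & adj x y]).

Definition reachable S : rel G := connect (fun x y => [set x; y] \in S.2).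

Definition sg_connected S : Prop :=
  S.1 != set0 /\ {in S.1 &, forall x y, reachable S x y}.

(* The graph with no vertices is neither connected nor disconnected. *)
Definition sg_disconnected S : Prop :=
  exists x y, [/\ x \in S.1, y \in S.1 & ~~ reachable S x y].

Definition sg_trivial S : Prop := #|S.1| = 1.

Definition removal F : subgraph G := induced (~: \bigcup_(S in F) S.1).

Definition subgraph_cut F : Prop :=
  (forall S, S \in F -> is_subgraph S) /\
  (sg_disconnected (removal F) \/ sg_trivial (removal F)).

End Subgraphs.

Definition sg_iso (G H : sgraph) (S : subgraph G) (K : subgraph H) : Prop :=
  exists f : G -> H,
    [/\ {in S.1 &, injective f},
        f @: S.1 = K.1 &
        {in S.1 &, forall x y,
           ([set x; y] \in S.2) = ([set f x; f y] \in K.2)}].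

Definition substructure_cut (G H : sgraph) (F : {set subgraph G}) : Prop :=
  subgraph_cut F /\
  forall S, S \in F ->
    exists K : subgraph H, [/\ is_subgraph K, sg_connected K & sg_iso S K].

(* [kappa_s_eq G H m] is "kappa^s(G; H) = m"; it includes the existence of an
   H-substructure cut. *)
Definition kappa_s_eq (G H : sgraph) (m : nat) : Prop :=
  (exists2 F : {set subgraph G}, substructure_cut H F & #|F| = m) /\
  (forall F : {set subgraph G}, substructure_cut H F -> m <= #|F|).

(* The i != j conjunct only matters for the degenerate value k = 1. *)
Definition cycle_adj (k : nat) (i j : 'I_k) : bool :=
  (i != j) && ((val j == i.+1 %% k) || (val i == j.+1 %% k)).

Lemma cycle_adj_sym k : symmetric (@cycle_adj k).
Proof. by move=> i j; rewrite /cycle_adj eq_sym orbC. Qed.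

Lemma cycle_adj_irrefl k : irreflexive (@cycle_adj k).
Proof. by move=> i; rewrite /cycle_adj eqxx. Qed.

Definition C_ (k : nat) : sgraph :=
  SGraph (@cycle_adj_sym k) (@cycle_adj_irrefl k).

(* The binary string u_{n-1} ... u_1 u_0 is the sequence
   [:: u_{n-1}; ...; u_1; u_0], so that prefixing is cons. *)
Definition bit (u : seq bool) (i : nat) : bool := nth false (rev u) i.

Definition pair_related (x y : bool * bool) : bool :=
  (x, y) \in [:: ((false, false), (false, false));
                 ((true,  false), (true,  false));
                 ((false, true),  (true,  true));
                 ((true,  true),  (false, true))].

(* The condition for 0u and 1v to be adjacent in CQ_n, where
   u = u_{n-2} ... u_0 and v = v_{n-2} ... v_0. *)
Definition cq_cross (n : nat) (u v : seq bool) : bool :=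
  (~~ odd n ==> (bit u (n - 2) == bit v (n - 2))) &&
  all (fun i => pair_related (bit u (2 * i + 1), bit u (2 * i))
                             (bit v (2 * i + 1), bit v (2 * i)))
      (iota 0 ((n - 1)./2)).

(* Adjacency in CQ_n of two strings of length n; the value at n = 0 is
   irrelevant. *)
Fixpoint cq_adj (n : nat) (u v : seq bool) : bool :=
  match n with
  | 0 => false
  | 1 => u != v
  | m.+1 =>
      match head false u, head false v with
      | false, true  => cq_cross n (behead u) (behead v)
      | true,  false => cq_cross n (behead v) (behead u)
      | _, _ => cq_adj m (behead u) (behead v)
      end
  end.

(* A vertex [x,y] of B_n is an ordered pair of strings of length n. For n >= 3
   it is in the copy of B_{n-1} prefixed by c iff x and y both start with c,
   and in S_n iff x starts with 0 and y starts with 1. *)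
Definition label := (seq bool * seq bool)%type.

Definition in_copy (c : bool) (p : label) : bool :=
  (ohead p.1 == Some c) && (ohead p.2 == Some c).

Definition in_cross (p : label) : bool :=
  (ohead p.1 == Some false) && (ohead p.2 == Some true).

Definition unprefix (p : label) : label := (behead p.1, behead p.2).

(* The values of the next two functions at n = 0, 1 are irrelevant. *)
Fixpoint bcdc_vertex (n : nat) (p : label) : bool :=
  match n with
  | 0 | 1 => false
  | 2 => p \in [:: ([:: false; false], [:: false; true]);
                   ([:: false; false], [:: true; false]);
                   ([:: false; true],  [:: true; true]);
                   ([:: true; false],  [:: true; true])]
  | m.+1 => [|| in_copy false p && bcdc_vertex m (unprefix p),
                in_copy true p && bcdc_vertex m (unprefix p) |
                in_cross p && cq_adj n p.1 p.2]
  end.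

Fixpoint bcdc_adj (n : nat) (p q : label) : bool :=
  match n with
  | 0 | 1 => false
  | 2 => (p != q) &&
         [|| p.1 == q.1, p.1 == q.2, p.2 == q.1 | p.2 == q.2]
  | m.+1 =>
      let low_cross p q :=
        [&& in_copy false p, in_cross q & (p.1 == q.1) || (p.2 == q.1)] in
      let cross_high p q :=
        [&& in_cross p, in_copy true q & (q.1 == p.2) || (q.2 == p.2)] in
      [|| [&& in_copy false p, in_copy false q
            & bcdc_adj m (unprefix p) (unprefix q)],
          [&& in_copy true p, in_copy true q
            & bcdc_adj m (unprefix p) (unprefix q)],
          low_cross p q, low_cross q p, cross_high p q | cross_high q p]
  end.

Lemma bcdc_adj_sym n : symmetric (bcdc_adj n).
Proof.
elim: n => [|[|[|m]] IH] p q //.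
  rewrite /= eq_sym (eq_sym p.1 q.1) (eq_sym p.1 q.2) (eq_sym p.2 q.1).
  by rewrite (eq_sym p.2 q.2); do !case: (_ == _).
have E a b c d e f a' b' : a = a' -> b = b' ->
  [|| a, b, c, d, e | f] = [|| a', b', d, c, f | e].
  by move=> -> ->; case: a' b' c d e f => [] [] [] [] [] [].
by apply: E; rewrite andbCA; congr [&& _, _ & _]; apply: IH.
Qed.

Lemma bcdc_adj_irrefl n : irreflexive (bcdc_adj n).
Proof.
elim: n => [|[|[|m]] IH] p //; first by rewrite /= eqxx.
have E a b c d : a = false -> b = false -> c = false -> d = false ->
  [|| a, b, c, c, d | d] = false by move=> -> -> -> ->.
apply: E; first by rewrite [X in [&& _, _ & X]]IH !andbF.
- by rewrite [X in [&& _, _ & X]]IH !andbF.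
- by case: p => [[|[] x] [|[] y]].
- by case: p => [[|[] x] [|[] y]].
Qed.

Definition bcdc_label (n : nat) (p : n.-tuple bool * n.-tuple bool) : label :=
  (tval p.1, tval p.2).

Definition bcdc_type (n : nat) :=
  {p : n.-tuple bool * n.-tuple bool | bcdc_vertex n (bcdc_label p)}.

Definition bcdc_rel (n : nat) : rel (bcdc_type n) :=
  fun p q => bcdc_adj n (bcdc_label (val p)) (bcdc_label (val q)).

Lemma bcdc_rel_sym n : symmetric (@bcdc_rel n).
Proof. by move=> p q; apply: bcdc_adj_sym. Qed.

Lemma bcdc_rel_irrefl n : irreflexive (@bcdc_rel n).
Proof. by move=> p; apply: bcdc_adj_irrefl. Qed.

Definition B_ (n : nat) : sgraph :=
  SGraph (@bcdc_rel_sym n) (@bcdc_rel_irrefl n).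

Definition ceil_divn (m d : nat) : nat := (m + d.-1) %/ d.

Lemma ceil_divn_leq m d q : 0 < d -> (ceil_divn m d <= q) = (m <= q * d).
Proof.
case: d => // d _; rewrite /ceil_divn /= -ltnS ltn_divLR // mulSn.
by rewrite addSn ltnS addnC leq_add2l.
Qed.

(* Main.v *)
Require Import Defs.
From mathcomp Require Import all_boot zify.

Set Implicit Arguments.
Unset Strict Implicit.
Unset Printing Implicit Defensive.

(** The vertices of [B_ n] are the edges of the crossed cube [CQ n], and two of
    them are adjacent iff they share an end ([bcdc_line_graph]). Hence deleting
    a vertex set U disconnects [B_ n] iff deleting the corresponding edges
    leaves [CQ n] with two components that both contain an edge. The vertex set
    X of the part of [CQ n] reached from one of them then has at least two
    vertices inside and two outside, and its whole edge boundary lies in U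
    ([disconnected_boundary]).

    [CQ n] consists of two copies of the next smaller crossed cube joined by a
    perfect matching, so edge boundaries can be estimated by induction, as in
    the hypercube: X has at least [2n-2] boundary edges, and strictly more if
    both X and its complement have at least three vertices
    ([cut_ge_edge_degree], [cut_gt_edge_degree]). So a cut of [B_ n] has at
    least [2n-2] vertices, and one with exactly [2n-2] is the neighbourhood of
    a vertex p of [B_ n] ([bcdc_cut_card]).

    A connected subgraph of [C_ k] has at most k vertices, so m of them cover at
    most mk, which gives [2n-2 <= mk]. If [mk = 2n-2], the members cover the
    neighbourhood of p exactly and without overlap. That neighbourhood consists
    of the [n-1] other edges at each end of p: two disjoint cliques, which have
    no edge between them because [CQ n] has no triangle. Each connected member
    then lies inside one of the cliques ([copy_side]) and k must divide [n-1]
    ([tight_cover_dvdn]).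

    Conversely, when k divides [n-1] each clique splits into [(n-1)/k] paths
    with k vertices. In general, take p as one side of a 4-cycle of [CQ n]: the
    opposite side is adjacent in [B_ n] to a vertex of each clique, so it links
    Hamiltonian paths of the two cliques into one path with [2n-1] vertices
    ([line_graph_paths]), which is chopped into pieces of at most k vertices
    ([path_cover]). Only an upper bound on the number of pieces has to be
    checked, since the lower bound holds for every cut. *)

(** * The crossed cube as two copies joined by a perfect matching *)

Lemma eq_bits m u v : size u = m -> size v = m ->
  (forall j, j < m -> bit u j = bit v j) -> u = v.
Proof.
move=> su sv uv; apply: (can_inj revK).
by apply: (@eq_from_nth _ false) => [|j]; rewrite !size_rev ?su ?sv // => /uv.
Qed.

Definition cross_bit (u : seq bool) (j : nat) : bool :=
  if odd j then bit u j (+) bit u j.-1 else bit u j.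

(** The matching between the two copies: pair relatedness adds the low bit of
    each pair to its high bit, and when the length m is odd the unpaired top bit
    sits at an even position, where [cross_bit] is the identity. *)
Definition cross_map (m : nat) (u : seq bool) : seq bool :=
  rev (mkseq (cross_bit u) m).

Lemma size_cross_map m u : size (cross_map m u) = m.
Proof. by rewrite size_rev size_mkseq. Qed.

Lemma bit_cross_map m u j : j < m -> bit (cross_map m u) j = cross_bit u j.
Proof. by move=> jm; rewrite /bit revK nth_mkseq. Qed.

Lemma cross_mapK m u : size u = m -> cross_map m (cross_map m u) = u.
Proof.
move=> su; apply: (@eq_bits m) => // [|j jm]; first exact: size_cross_map.
rewrite bit_cross_map // /cross_bit !bit_cross_map //; last by lia.
case: ifP => [oj|oj]; rewrite /cross_bit oj //.
have -> : odd j.-1 = false by lia.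
by rewrite -addbA addbb addbF.
Qed.

Lemma pair_relatedE x y :
  pair_related x y = (y.1 == x.1 (+) x.2) && (y.2 == x.2).
Proof. by case: x y => [[] []] [[] []]. Qed.

Lemma cq_crossE m u v : size u = m -> size v = m ->
  cq_cross m.+1 u v = (v == cross_map m u).
Proof.
move=> su sv; rewrite /cq_cross !subSS subn0 /=.
apply/andP/eqP => [[top /allP prs]|->].
  apply: (@eq_bits m); rewrite ?size_cross_map // => j jm.
  rewrite bit_cross_map // /cross_bit.
  have [ij|ij] := ltnP j./2 m./2.
    have := prs j./2; rewrite mem_iota add0n ij => /(_ isT).
    rewrite pair_relatedE /= => /andP[/eqP e1 /eqP e0].
    case: ifP => oj.
      have ej : 2 * j./2 + 1 = j by lia.
      have ej' : 2 * j./2 = j.-1 by lia.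
      by move: e1; rewrite ej ej'.
    have ej : 2 * j./2 = j by lia.
    by move: e0; rewrite ej.
  have oj : odd j = false by lia.
  have om : odd m by lia.
  have ej : m - 1 = j by lia.
  by rewrite oj; move: top; rewrite om ej /= => /eqP.
split.
  apply/implyP; rewrite negbK => om.
  rewrite bit_cross_map; last by lia.
  have om1 : odd (m - 1) = false by lia.
  by rewrite /cross_bit om1.
apply/allP => i; rewrite mem_iota add0n => /andP[_ im].
have i1m : 2 * i + 1 < m by lia.
have i0m : 2 * i < m by lia.
rewrite pair_relatedE /= !bit_cross_map // /cross_bit.
have -> : odd (2 * i + 1) by lia.
have -> : odd (2 * i) = false by lia.
by rewrite addn1 /= !eqxx.
Qed.

Lemma cq_adj_cons m b c u v : size u = m -> size v = m ->
  cq_adj m.+1 (b :: u) (c :: v) =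
  if b == c then cq_adj m u v else v == cross_map m u.
Proof.
move=> su sv.
have crossC : cq_cross m.+1 v u = (v == cross_map m u).
  rewrite cq_crossE //; apply/eqP/eqP => ->; by rewrite cross_mapK.
case: m su sv crossC => [|m] su sv crossC.
  by move: su sv; case: u v b c {crossC} => [|//] [|//] [] [].
case: b c => [] [] //=.
exact: cq_crossE.
Qed.

Lemma cq_adj_sym n : symmetric (cq_adj n).
Proof.
elim: n => [|[|m] IH] u v //; first by rewrite /= eq_sym.
by rewrite /=; case: (head _ u) (head _ v) => [] [] //; apply: IH.
Qed.

Lemma cq_adj_irrefl n : irreflexive (cq_adj n).
Proof.
elim: n => [|[|m] IH] u //; first by rewrite /= eqxx.
by rewrite /=; case: (head _ u); apply: IH.
Qed.

Definition cq_rel n : rel (n.-tuple bool) := fun u v => cq_adj n u v.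

Definition CQ n : sgraph :=
  @SGraph (n.-tuple bool) (@cq_rel n)
    (fun u v => cq_adj_sym n u v) (fun u => cq_adj_irrefl n u).

(** Two vertices in one copy never have a common neighbour in the other copy,
    because the edges between the copies form a matching. *)
Lemma cq_triangle_free n u v w : size u = n -> size v = n -> size w = n ->
  cq_adj n u v -> cq_adj n u w -> cq_adj n v w -> False.
Proof.
elim: n u v w => [//|n IH] [//|a u] [//|b v] [//|c w] [su] [sv] [sw].
rewrite !cq_adj_cons //.
have irr x : size x = n -> cq_adj n x x = false by rewrite cq_adj_irrefl.
have inj x y : size x = n -> size y = n ->
    cross_map n x = cross_map n y -> x = y.
  by move=> sx sy e; rewrite -[x](cross_mapK sx) e cross_mapK.
case: a b c => [] [] [] //=; first [exact: IH | idtac].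
- by move=> uv /eqP -> /eqP /inj; move=> /(_ su sv) e; move: uv; rewrite e irr.
- by move=> /eqP vu uw /eqP wv; move: uw; rewrite wv vu cross_mapK // irr.
- by move=> /eqP -> /eqP ->; rewrite irr // size_cross_map.
- by move=> /eqP -> /eqP ->; rewrite irr // size_cross_map.
- by move=> /eqP vu uw /eqP wv; move: uw; rewrite wv vu cross_mapK // irr.
- by move=> uv /eqP -> /eqP /inj; move=> /(_ su sv) e; move: uv; rewrite e irr.
Qed.

Lemma sum_tuple_cons n (F : n.+1.-tuple bool -> nat) :
  \sum_s F s =
  \sum_(s : n.-tuple bool) F (cons_tuple false s) +
  \sum_(s : n.-tuple bool) F (cons_tuple true s).
Proof.
pose h (p : bool * n.-tuple bool) := cons_tuple p.1 p.2.
have hK : bijective h.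
  exists (fun s => (thead s, behead_tuple s)) => [[b s]|s].
    by congr pair; apply: val_inj.
  by rewrite /h /= [RHS]tuple_eta; apply: val_inj.
rewrite (reindex h) /=; last exact: onW_bij.
rewrite -(pair_bigA _ (fun b s => F (cons_tuple b s))) /=.
by rewrite big_bool addnC.
Qed.

Definition cross_tuple n (s : n.-tuple bool) : n.-tuple bool :=
  Tuple (introT eqP (size_cross_map n s)).

Lemma cross_tupleK n : involutive (@cross_tuple n).
Proof. by move=> s; apply/val_inj/cross_mapK/size_tuple. Qed.

Lemma sum_pick (T : finType) (a : T) (F : pred T) :
  \sum_t (F t && (t == a)) = F a.
Proof.
rewrite (bigD1 a) //= eqxx andbT big1 ?addn0 // => t /negPf ->.
by rewrite andbF.
Qed.

Lemma cq_degree n (s : n.-tuple bool) :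
  \sum_(t : n.-tuple bool) cq_adj n s t = n.
Proof.
elim: n s => [|n IH] s; first by rewrite big1.
rewrite sum_tuple_cons (tuple_eta s).
have E b c (u : n.-tuple bool) :
    \sum_(t : n.-tuple bool) cq_adj n.+1 (b :: u) (c :: t) =
    if b == c then n else 1.
  under eq_bigr => t _ do rewrite cq_adj_cons ?size_tuple //.
  case: eqP => _; first exact: IH.
  by have := sum_pick (cross_tuple u) xpredT.
have E' c := E (thead s) c (behead_tuple s).
apply: etrans (congr2 addn (E' false) (E' true)) _.
by case: (thead s); rewrite ?addn1 ?add1n.
Qed.

(** * Edge boundaries in the crossed cube *)

(** Vertex sets are predicates on all bit strings here, so that the traces of
    one on the two copies ([half]) are again such predicates. *)
Definition cut n (P : pred (seq bool)) : nat :=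
  \sum_(s : n.-tuple bool) \sum_(t : n.-tuple bool)
    ((P s && ~~ P t) && cq_adj n s t).

Definition weight n (P : pred (seq bool)) : nat := \sum_(s : n.-tuple bool) P s.

Definition half (b : bool) (P : pred (seq bool)) : pred (seq bool) :=
  fun s => P (b :: s).

Lemma weight_cons n P :
  weight n.+1 P = weight n (half false P) + weight n (half true P).
Proof. exact: sum_tuple_cons. Qed.

Lemma weightC n P : weight n P + weight n (predC P) = 2 ^ n.
Proof.
rewrite /weight -big_split /=.
under eq_bigr => s _ do rewrite /= addnC addn_negb.
by rewrite sum1_card card_tuple card_bool.
Qed.

(** The matching is a bijection, so it sends at most as many elements of P into
    Q as Q has. *)
Lemma weight_diff_le n (P Q : pred (seq bool)) :
  weight n P - weight n Q <=
  \sum_(s : n.-tuple bool) (P s && ~~ Q (cross_tuple s)).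
Proof.
rewrite leq_subLR /weight.
rewrite [X in _ <= X + _](reindex_inj (inv_inj (@cross_tupleK n))) /=.
by rewrite -big_split; apply: leq_sum => s _; case: (P s); case: (Q _).
Qed.

(** The two differences bound from below the matching edges that leave P from
    either half; subtraction being truncated, at most one of them is nonzero. *)
Lemma cut_cons n P :
  cut n (half false P) + cut n (half true P) +
  (weight n (half false P) - weight n (half true P)) +
  (weight n (half true P) - weight n (half false P)) <= cut n.+1 P.
Proof.
pose X b c :=
  \sum_(s : n.-tuple bool) (P (b :: s) && ~~ P (c :: cross_tuple s)).
have E b c : \sum_(s : n.-tuple bool) \sum_(t : n.-tuple bool)
    ((P (b :: s) && ~~ P (c :: t)) && cq_adj n.+1 (b :: s) (c :: t)) =
  if b == c then cut n (half b P) else X b c.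
  case: (eqVneq b c) => [<-|/negPf bc]; apply: eq_bigr => s _.
    by apply: eq_bigr => t _; rewrite cq_adj_cons ?size_tuple // eqxx.
  rewrite -(sum_pick (cross_tuple s) (fun t => P (b :: s) && ~~ P (c :: t))).
  by apply: eq_bigr => t _; rewrite cq_adj_cons ?size_tuple // bc.
have S b : \sum_(s : n.-tuple bool) \sum_(t : n.+1.-tuple bool)
    ((P (b :: s) && ~~ P t) && cq_adj n.+1 (b :: s) t) =
  (if b == false then cut n (half b P) else X b false) +
  (if b == true then cut n (half b P) else X b true).
  rewrite -!E -big_split; apply: eq_bigr => s _.
  by rewrite sum_tuple_cons.
have D b c : weight n (half b P) - weight n (half c P) <= X b c.
  exact: weight_diff_le.
rewrite {3}/cut sum_tuple_cons.
apply: leq_trans (eq_leq (esym (congr2 addn (S false) (S true)))).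
move: X D {E S} => X D; have := D false true; have := D true false.
by rewrite /=; lia.
Qed.

(** If both halves are proper and nonempty, each contributes its degree [n-1] and
    [2(n-1) >= n]; if one half is empty or full, the matching edges make up for
    the missing cut. *)
Lemma cut_ge_degree n P :
  0 < weight n P -> 0 < weight n (predC P) -> n <= cut n P.
Proof.
elim: n P => [//|n IH] P.
have := cut_cons n P.
set P0 := half false P; set P1 := half true P.
have := weightC n P0; have := weightC n P1; have := IH P0; have := IH P1.
have -> : weight n.+1 P = weight n P0 + weight n P1 by exact: weight_cons.
have -> : weight n.+1 (predC P) = weight n (predC P0) + weight n (predC P1).
  exact: weight_cons.
have : n < 2 ^ n by apply: ltn_expl.
case: n {IH} => [|n]; first by rewrite expn0; lia.
lia.
Qed.

(** If both halves are proper and nonempty, each of them contributes [n-1] by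
    [cut_ge_degree]; otherwise the matching adds an edge for each vertex of P in
    the other half, or for each missing one, which with the induction hypothesis
    there, or with [cut_ge_degree], is enough. *)
Lemma cut_ge_edge_degree n P :
  1 < weight n P -> 1 < weight n (predC P) -> 2 * n - 2 <= cut n P.
Proof.
elim: n P => [//|n IH] P.
have := cut_cons n P.
set P0 := half false P; set P1 := half true P.
have := weightC n P0; have := weightC n P1; have := IH P0; have := IH P1.
have := @cut_ge_degree n P0; have := @cut_ge_degree n P1.
have -> : weight n.+1 P = weight n P0 + weight n P1 by exact: weight_cons.
have -> : weight n.+1 (predC P) = weight n (predC P0) + weight n (predC P1).
  exact: weight_cons.
have : n < 2 ^ n by apply: ltn_expl.
have : 2 * n <= 2 ^ n.
  by case: (n) => // m; rewrite expnS leq_mul2l ltn_expl.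
lia.
Qed.

(** The bounds for the halves add up to enough, except when one half has one
    vertex and the other all but one; then nearly all matching edges are cut.
    The bound fails for [n = 3], where a 4-cycle has only 4 boundary edges. *)
Lemma cut_gt_edge_degree n P : 3 < n ->
  2 < weight n P -> 2 < weight n (predC P) -> 2 * n - 2 < cut n P.
Proof.
case: n => [//|n] n3.
have := cut_cons n P.
set P0 := half false P; set P1 := half true P.
have := weightC n P0; have := weightC n P1.
have := @cut_ge_edge_degree n P0; have := @cut_ge_edge_degree n P1.
have := @cut_ge_degree n P0; have := @cut_ge_degree n P1.
have -> : weight n.+1 P = weight n P0 + weight n P1 by exact: weight_cons.
have -> : weight n.+1 (predC P) = weight n (predC P0) + weight n (predC P1).
  exact: weight_cons.
have : 2 * n + 2 <= 2 ^ n.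
  elim: n n3 {P0 P1} => [//|n IH] n3.
  case: (ltnP 3 n.+1) => [n4|]; last first.
    by move=> n4; have -> : n = 2 by lia.
  by have := IH n4; rewrite expnS; lia.
lia.
Qed.

(** * The BCDC network is the line graph of the crossed cube *)

Lemma eq_set2 (T : finType) (x y a b : T) :
  [set x; y] = [set a; b] -> (x = a /\ y = b) \/ (x = b /\ y = a).
Proof.
move=> e.
have : x \in [set a; b] by rewrite -e set21.
have : y \in [set a; b] by rewrite -e set22.
have : a \in [set x; y] by rewrite e set21.
have : b \in [set x; y] by rewrite e set22.
rewrite !in_set2; do 4!case/orP=> /eqP ?; subst; by [left | right].
Qed.

Record line_graph (G L : sgraph) (ends : L -> {set G}) : Prop := LineGraph {
  ends_inj : injective ends;
  ends_edge : forall p, exists x y, adj x y /\ ends p = [set x; y];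
  edge_ends : forall x y : G, adj x y -> exists p, ends p = [set x; y];
  ends_adj : forall p q, adj p q = (p != q) && ~~ [disjoint ends p & ends q]
}.

Definition share (p q : label) : bool :=
  [|| p.1 == q.1, p.1 == q.2, p.2 == q.1 | p.2 == q.2].

Lemma bcdc_vertex_cons n b c u v : 1 < n -> size u = n -> size v = n ->
  bcdc_vertex n.+1 (b :: u, c :: v) =
  if b == c then bcdc_vertex n (u, v) else (~~ b && (v == cross_map n u)).
Proof.
case: n => [|[|n]] // _ su sv.
have := @cq_adj_cons n.+2 b c u v su sv.
rewrite /bcdc_vertex -/(bcdc_vertex _ _) /in_copy /in_cross /unprefix.
move: (cq_adj _ _ _) => X /= ->.
by case: b c => [] [] /=; rewrite ?orbF.
Qed.

(** Exactly one of the two orientations of an edge is a vertex label: the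
    exclusive or is what makes the map from labels to edges injective. *)
Lemma bcdc_vertex_edge n u v : 1 < n -> size u = n -> size v = n ->
  cq_adj n u v = bcdc_vertex n (u, v) (+) bcdc_vertex n (v, u).
Proof.
elim: n u v => [//|n IH] [//|b u] [//|c v] n1 [su] [sv].
rewrite cq_adj_cons //.
have [n1'|n1'] := ltnP 1 n.
  rewrite !bcdc_vertex_cons // (eq_sym c b); case: eqP => [_|]; first exact: IH.
  have -> : (u == cross_map n v) = (v == cross_map n u).
    by apply/eqP/eqP => ->; rewrite cross_mapK.
  by case: b c => [] [] //; rewrite /= ?addbF.
have n2 : n = 1 by lia.
rewrite n2 in su sv *; case: u su => [|x [|]] // _; case: v sv => [|y [|]] // _.
by case: b c x y => [] [] [] [].
Qed.

Lemma bcdc_vertex_adj n u v : 1 < n -> size u = n -> size v = n ->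
  bcdc_vertex n (u, v) -> cq_adj n u v.
Proof.
elim: n u v => [//|n IH] [//|b u] [//|c v] n1 [su] [sv].
have [n1'|n1'] := ltnP 1 n.
  rewrite cq_adj_cons // bcdc_vertex_cons //; case: eqP => [_|_ /andP[]//].
  exact: IH.
have n2 : n = 1 by lia.
rewrite n2 in su sv *; case: u su => [|x [|]] // _; case: v sv => [|y [|]] // _.
by case: b c x y => [] [] [] [].
Qed.

Arguments bcdc_vertex : simpl never.
Arguments bcdc_adj : simpl never.

Lemma bcdc_adj_cons n b c d e u v x y : 1 < n ->
  bcdc_adj n.+1 (b :: u, c :: v) (d :: x, e :: y) =
  if b == c then
    if d == e then (b == d) && bcdc_adj n (u, v) (x, y)
    else ~~ d && (if b then (u == y) || (v == y) else (u == x) || (v == x))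
  else
    [&& d == e, ~~ b &
        if d then (x == v) || (y == v) else (x == u) || (y == u)].
Proof.
case: n => [|[|n]] // _.
have unf p q : bcdc_adj n.+3 p q =
  [|| [&& in_copy false p, in_copy false q
        & bcdc_adj n.+2 (unprefix p) (unprefix q)],
      [&& in_copy true p, in_copy true q
        & bcdc_adj n.+2 (unprefix p) (unprefix q)],
      [&& in_copy false p, in_cross q & (p.1 == q.1) || (p.2 == q.1)],
      [&& in_copy false q, in_cross p & (q.1 == p.1) || (q.2 == p.1)],
      [&& in_cross p, in_copy true q & (q.1 == p.2) || (q.2 == p.2)] |
      [&& in_cross q, in_copy true p & (p.1 == q.2) || (p.2 == q.2)]] by [].
rewrite unf /in_copy /in_cross /unprefix.
case: b c d e => [] [] [] [] //=;
  by rewrite ?eqseq_cons ?orbF ?andbF.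
Qed.

Lemma bcdc_adj_share n u v x y : 1 < n ->
  size u = n -> size v = n -> size x = n -> size y = n ->
  bcdc_vertex n (u, v) -> bcdc_vertex n (x, y) ->
  bcdc_adj n (u, v) (x, y) = ((u, v) != (x, y)) && share (u, v) (x, y).
Proof.
elim: n u v x y => [//|[//|[//|n]] IH] [//|b u] [//|c v] [//|d x] [//|e y].
move=> n1 [su] [sv] [sx] [sy].
rewrite !bcdc_vertex_cons // bcdc_adj_cons // /share.
rewrite !xpair_eqE !eqseq_cons /=.
case: (eqVneq b c) => [<-{c}|bc]; case: (eqVneq d e) => [<-{e}|de] V1 V2.
- case: (eqVneq b d) => _ //=; exact: IH.
- by case: d e b de V1 V2 => [] [] [] //= *; rewrite ?orbF ?andbF.
- case: b c d bc V1 V2 => [] [] [] //= *.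
    by rewrite ?andbF eq_sym (eq_sym y).
  by rewrite ?andbF ?orbF eq_sym (eq_sym y).
- case: b c d e bc de V1 V2 => [] [] [] [] //= _ _ /eqP -> /eqP ->.
  rewrite (inj_in_eq (D := [pred s | size s == n.+2])) ?inE ?su ?sx //.
    by case: eqP.
  by move=> s t /eqP ss /eqP st e; rewrite -(cross_mapK ss) e cross_mapK.
Qed.

Definition bcdc_ends n (p : B_ n) : {set CQ n} := [set (val p).1; (val p).2].

Lemma bcdc_line_graph n : 1 < n -> line_graph (@bcdc_ends n).
Proof.
move=> n1; split.
- move=> [[u v] p] [[x y] q] /eq_set2 /= [[eu ev]|[eu ev]].
    by apply: val_inj; rewrite /= eu ev.
  have := bcdc_vertex_edge n1 (size_tuple u) (size_tuple v).
  have := bcdc_vertex_adj n1 (size_tuple u) (size_tuple v) p.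
  move: (p) (q); rewrite /bcdc_label /= eu ev => p' q' ->.
  by rewrite p' q'.
- case=> [[u v] p]; exists u, v; split=> //.
  exact: bcdc_vertex_adj n1 (size_tuple u) (size_tuple v) p.
- move=> u v; change (cq_adj n u v -> exists p, bcdc_ends p = [set u; v]).
  rewrite bcdc_vertex_edge ?size_tuple //.
  case uv: (bcdc_vertex n (tval u, tval v)).
    by exists (exist _ (u, v) uv).
  by rewrite /= => vu; exists (exist _ (v, u) vu); rewrite setUC.
- case=> [[u v] p] [[x y] q].
  have := bcdc_adj_share n1 (size_tuple u) (size_tuple v)
    (size_tuple x) (size_tuple y) p q.
  rewrite /adj /= /bcdc_rel /= => ->.
  rewrite /bcdc_ends /= -(inj_eq val_inj) /= -setI_eq0; congr (_ && _).
  apply/idP/set0Pn => [|[z]]; rewrite /share /=.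
    case/or4P => /eqP/val_inj e; [exists u|exists u|exists v|exists v];
    by rewrite !inE e eqxx ?orbT.
  rewrite !inE => /andP[/orP[]/eqP -> /orP[]/eqP ->]; by rewrite eqxx ?orbT.
Qed.

(** * Vertex cuts of line graphs *)

Lemma adj_neq (G : sgraph) (x y : G) : adj x y -> x != y.
Proof. by apply: contraTneq => ->; rewrite adj_irrefl. Qed.

Lemma subgraph_edge (G : sgraph) (S : subgraph G) x y :
  is_subgraph S -> [set x; y] \in S.2 -> [/\ x \in S.1, y \in S.1 & adj x y].
Proof.
move=> sS /sS [a [b [aS bS ab]]] /eq_set2 [[-> ->]|[-> ->]] //.
by rewrite adj_sym.
Qed.

Lemma induced_is_subgraph (G : sgraph) (W : {set G}) : is_subgraph (induced W).
Proof.
move=> A /imset2P [x y xW]; rewrite inE => /andP[yW xy] ->.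
by exists x, y.
Qed.

Lemma induced_edge (G : sgraph) (W : {set G}) x y :
  ([set x; y] \in (induced W).2) = [&& x \in W, y \in W & adj x y].
Proof.
apply/idP/and3P => [|[xW yW xy]].
  by case/(subgraph_edge (@induced_is_subgraph G W)).
by apply/imset2P; exists x y; rewrite ?inE ?yW.
Qed.

Section LineGraphs.
Variables (G L : sgraph) (ends : L -> {set G}).
Hypothesis LG : line_graph ends.

Definition arcs (X : {set G}) : {set G * G} :=
  [set z | [&& z.1 \in X, z.2 \notin X & adj z.1 z.2]].

Definition boundary (X : {set G}) : {set L} :=
  [set p | ~~ [disjoint ends p & X] && ~~ (ends p \subset X)].

Definition star (a : G) : {set L} := [set p | a \in ends p].

Definition nbr (p : L) : {set L} := [set q | adj p q].

(** An arc is determined by the edge under it, since only its source is in X. *)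
Lemma card_boundary X : #|arcs X| <= #|boundary X|.
Proof.
pose h (z : G * G) := [set z.1; z.2].
have hI : {in arcs X &, injective h}.
  move=> [x y] [a b]; rewrite !inE /= => /and3P[xX yX _] /and3P[aX bX _].
  case/eq_set2 => /= [[-> ->] //|[xb _]].
  by move: xX; rewrite xb (negPf bX).
rewrite -(card_in_imset hI); apply: leq_trans (leq_imset_card ends _).
apply/subset_leq_card/subsetP => A /imsetP[[x y]]; rewrite inE /=.
case/and3P => xX yX /(edge_ends LG)[p ep] ->{A}; apply/imsetP; exists p => //.
rewrite inE ep -setI_eq0; apply/andP; split.
  by apply/set0Pn; exists x; rewrite !inE eqxx.
by apply: contra yX => /subsetP; apply; rewrite set22.
Qed.

Lemma boundaryC X : boundary (~: X) = boundary X.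
Proof.
apply/setP => p; rewrite !inE andbC disjoints_subset setCK.
by rewrite subsets_disjoint setCK.
Qed.

Lemma card_ends p : #|ends p| = 2.
Proof.
by have [x [y [/adj_neq xy ->]]] := ends_edge LG p; rewrite cards2 xy.
Qed.

Lemma boundary_ends p : boundary (ends p) = nbr p.
Proof.
apply/setP => q; rewrite !inE (ends_adj LG) andbC disjoint_sym; congr (_ && _).
by rewrite eq_sym -(inj_eq (ends_inj LG)) eqEcard !card_ends leqnn andbT.
Qed.

Lemma nbr_star a b p : ends p = [set a; b] ->
  nbr p = (star a :\ p) :|: (star b :\ p).
Proof.
move=> ep; apply/setP => q.
rewrite !inE (ends_adj LG) -andb_orr eq_sym; congr (_ && _).
rewrite ep -setI_eq0; apply/set0Pn/orP => [[z]|[]z]; rewrite ?inE.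
- by case/andP => /orP[]/eqP-> ->; [left|right].
- by exists a; rewrite !inE eqxx.
- by exists b; rewrite !inE eqxx orbT.
Qed.

Lemma star_pair a b p q :
  ends p = [set a; b] -> q \in star a -> q \in star b -> q = p.
Proof.
move=> ep; rewrite !inE => aq bq; apply/esym/(ends_inj LG)/eqP.
by rewrite eqEcard !card_ends leqnn andbT ep subUset !sub1set aq.
Qed.

Lemma card_star_del a p : p \in star a -> #|star a :\ p| = #|star a| - 1.
Proof. by move=> pa; rewrite (cardsD1 p (star a)) pa add1n subn1. Qed.

Lemma star_clique a p q : p \in star a -> q \in star a -> p != q -> adj p q.
Proof.
rewrite !inE => ap aq pq; rewrite (ends_adj LG) pq -setI_eq0.
by apply/set0Pn; exists a; rewrite inE ap.
Qed.

Lemma starP a p : reflect (exists2 b, adj a b & ends p = [set a; b])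
  (p \in star a).
Proof.
rewrite inE; apply: (iffP idP) => [|[b _ ->]]; last exact: set21.
have [x [y [xy ->]]] := ends_edge LG p.
rewrite !inE => /orP[]/eqP->; first by exists y.
by exists x; rewrite 1?setUC // adj_sym.
Qed.

Lemma card_star a : #|star a| = #|[set b | adj a b]|.
Proof.
have hI : {in [set b | adj a b] &, injective (fun b => [set a; b])}.
  move=> b c _ _ /eq_set2 [[_ //]|[-> ->]] //.
rewrite -(card_imset _ (ends_inj LG)) -(card_in_imset hI).
congr #|pred_of_set _|; apply/setP => A; apply/imsetP/imsetP => [[p /starP]|].
  by case=> b ab ep ->; exists b; rewrite ?inE.
case=> b; rewrite inE => /(edge_ends LG)[p ep] ->; exists p => //.
by rewrite inE ep set21.
Qed.

Hypothesis triangle_free :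
  forall x y z : G, adj x y -> adj x z -> adj y z -> False.

(** Edges at the two ends of p that meet outside p would form a triangle with
    p. *)
Lemma stars_nonadjacent a b p q r : ends p = [set a; b] ->
  q \in star a :\ p -> r \in star b :\ p -> ~~ adj q r.
Proof.
move=> ep; rewrite in_setD1 => /andP[qp qa]; rewrite in_setD1 => /andP[rp rb].
apply/negP; rewrite (ends_adj LG) => /andP[qr].
have /starP[c ac eq] := qa; have /starP[d bd er] := rb.
have ab : adj a b.
  have /starP[b' ab' ep'] : p \in star a by rewrite inE ep set21.
  move: (ep'); rewrite ep => /eq_set2 [[_ ->] //|[e _]].
  by move: ab'; rewrite -e adj_irrefl.
rewrite -setI_eq0 => /set0Pn[z].
rewrite eq er !inE => /andP[/orP[]/eqP-> /orP[]/eqP].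
- by move=> e; move: ab; rewrite e adj_irrefl.
- move=> e; case/negP: rp; apply/eqP/(star_pair ep); last exact: rb.
  by rewrite inE er e set22.
- move=> e; case/negP: qp; apply/eqP/(star_pair ep); first exact: qa.
  by rewrite inE eq e set22.
- by move=> e; apply: (triangle_free ab ac); rewrite e.
Qed.

(** X consists of the ends of all the edges reachable from a fixed one. An edge
    of W with one end in X meets a reachable edge, so it is reachable itself and
    has both ends in X. *)
Lemma disconnected_boundary (W : {set L}) : sg_disconnected (induced W) ->
  exists (X : {set G}) p q, [/\ p \in W, q \in W, ends p \subset X,
    ends q \subset ~: X & boundary X \subset ~: W].
Proof.
case=> x [y [xW yW xy]]; pose R := reachable (induced W).
have step p q : p \in W -> q \in W -> ~~ [disjoint ends p & ends q] ->
    R x p -> R x q.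
  move=> pW qW pq xp; have [<- //|npq] := eqVneq p q.
  apply: connect_trans xp (connect1 _).
  by rewrite induced_edge pW qW (ends_adj LG) npq.
pose X := [set a | [exists p, [&& p \in W, R x p & a \in ends p]]].
exists X, x, y; split=> //.
- apply/subsetP => a ax; rewrite inE; apply/existsP; exists x.
  by rewrite xW ax andbT; apply: connect0.
- apply/subsetP => a ay; rewrite !inE; apply: contra xy => /existsP[p].
  case/and3P => pW xp ap; apply: step pW yW _ xp.
  by rewrite -setI_eq0; apply/set0Pn; exists a; rewrite inE ap.
apply/subsetP => p; rewrite !inE -setI_eq0 => /andP[/set0Pn[a]].
rewrite !inE => /andP[ap /existsP[q /and3P[qW xq aq]]].
apply: contra => pW; apply/subsetP => b bp; rewrite inE; apply/existsP.
exists p; rewrite pW bp andbT; apply: step qW pW _ xq.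
by rewrite -setI_eq0; apply/set0Pn; exists a; rewrite inE aq.
Qed.

Variable d : nat.
Hypothesis arcs_ge : forall X : {set G},
  1 < #|X| -> 1 < #|~: X| -> d <= #|arcs X|.
Hypothesis arcs_gt : forall X : {set G},
  2 < #|X| -> 2 < #|~: X| -> d < #|arcs X|.

(** When equality holds, X or its complement has exactly two vertices; these are
    the ends of an edge, whose boundary is its neighbourhood. *)
Lemma disconnected_card (U : {set L}) : sg_disconnected (induced (~: U)) ->
  d <= #|U| /\ (#|U| = d -> exists p, U = nbr p).
Proof.
case/disconnected_boundary => X [p [q [_ _ pX qX]]]; rewrite setCK => bU.
have X1 : 1 < #|X| by rewrite -(card_ends p) subset_leq_card.
have Y1 : 1 < #|~: X| by rewrite -(card_ends q) subset_leq_card.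
have le := leq_trans (arcs_ge X1 Y1) (card_boundary X).
split=> [|Ud]; first exact: leq_trans le (subset_leq_card bU).
have bE : boundary X = U by apply/eqP; rewrite eqEcard bU Ud.
have [X2|X2] := ltnP 2 #|X|; last first.
  exists p; rewrite -bE -boundary_ends; congr boundary; apply/esym/eqP.
  by rewrite eqEcard pX card_ends.
have [Y2|Y2] := ltnP 2 #|~: X|; last first.
  exists q; rewrite -bE -boundary_ends -boundaryC; congr boundary.
  by apply/esym/eqP; rewrite eqEcard qX card_ends.
have := leq_trans (arcs_gt X2 Y2) (card_boundary X).
by rewrite bE Ud ltnn.
Qed.

End LineGraphs.

(** * Copies of connected subgraphs of a graph *)

Definition copy_in (G H : sgraph) (S : subgraph G) : Prop :=
  exists K : subgraph H, [/\ is_subgraph K, sg_connected K & sg_iso S K].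

Lemma copy_card (G H : sgraph) (S : subgraph G) : copy_in H S -> #|S.1| <= #|H|.
Proof.
by case=> K [_ _ [f [fI _ _]]]; rewrite -(card_in_imset fI) max_card.
Qed.

(** A path in the copy inside H lifts to S edge by edge and cannot leave A. *)
Lemma copy_side (G H : sgraph) (S : subgraph G) (A B : {set G}) :
  is_subgraph S -> copy_in H S -> S.1 \subset A :|: B ->
  {in A & B, forall x y, ~~ adj x y} ->
  S.1 \subset A \/ S.1 \subset B.
Proof.
move=> sS [K [sK [_ cK] [f [fI fS fE]]]] /subsetP SAB nAB.
have [|/subsetPn[b bS bB]] := boolP (S.1 \subset B); first by right.
left; have bA : b \in A by move: (SAB b bS); rewrite inE (negPf bB) orbF.
apply/subsetP => y yS.
have fK x : x \in S.1 -> f x \in K.1 by rewrite -fS; apply: imset_f.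
have /connectP[p] := cK _ _ (fK b bS) (fK y yS).
elim: p b bS bA {bB} => [|w p IH] x xS xA /=.
  by move=> _ /fI ->.
case/andP => xw pp lp.
have [_ wK _] := subgraph_edge sK xw.
move: wK; rewrite -fS => /imsetP[z zS wz].
have zA : z \in A.
  move: xw; rewrite wz -fE // => xz.
  have := SAB z zS; rewrite inE => /orP[//|zB].
  by have [_ _] := subgraph_edge sS xz; rewrite (negPf (nAB x z xA zB)).
by apply: (IH z zS zA); rewrite -wz.
Qed.

(** * Covering paths by pieces that embed in a cycle *)

Definition cycle_segment (k m : nat) : subgraph (C_ k) :=
  ([set i : C_ k | val i < m],
   [set [set z.1; z.2] | z in [set z : C_ k * C_ k |
      (val z.2 < m) && (val z.2 == (val z.1).+1)]]).

Lemma cycle_segment_edge k m (A : {set C_ k}) :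
  A \in (cycle_segment k m).2 ->
  exists i j, [/\ val j < m, val j = (val i).+1 & A = [set i; j]].
Proof.
by case/imsetP => -[i j]; rewrite inE /= => /andP[jm /eqP ji] ->; exists i, j.
Qed.

Lemma cycle_segment_subgraph k m : m <= k -> is_subgraph (cycle_segment k m).
Proof.
move=> mk A /cycle_segment_edge [i [j [jm ji ->]]]; exists i, j.
have jk : (val i).+1 < k by rewrite -ji (leq_trans jm mk).
rewrite !inE jm ltnW -?ji //; split=> //.
rewrite /adj /= /cycle_adj -val_eqE ji modn_small //.
by rewrite eqxx /= andbT neq_ltn ltnSn.
Qed.

Lemma cycle_segment_connected k m : 0 < m -> m <= k ->
  sg_connected (cycle_segment k m).
Proof.
move=> m0 mk; have k0 : 0 < k by lia.
pose o : C_ k := Ordinal k0.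
split; first by apply/set0Pn; exists o; rewrite inE.
pose e (x y : C_ k) := [set x; y] \in (cycle_segment k m).2.
have eC : connect_sym e by apply: sym_connect_sym => x y; rewrite /e setUC.
have oi j (jk : j < k) : j < m -> connect e o (Ordinal jk).
  elim: j jk => [|j IH] jk jm.
    by have -> : Ordinal jk = o by apply: val_inj.
  have jk' : j < k by lia.
  apply: connect_trans (IH jk' (ltnW jm)) (connect1 _).
  apply/imsetP; exists (Ordinal jk', Ordinal jk) => //.
  by rewrite inE /= jm eqxx.
move=> [i ik] [j jk]; rewrite !inE /= => im jm.
by apply: (connect_trans (y := o)); [rewrite eC|]; apply: oi.
Qed.

(** The edges of the copy are pulled back from the segment of the cycle along
    the position in s, which makes the isomorphism condition immediate. *)
Lemma path_copy (G : sgraph) k (s : seq G) :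
  0 < size s <= k -> uniq s -> sorted (@adj G) s ->
  exists S : subgraph G,
    [/\ S.1 = [set x in s], is_subgraph S & copy_in (C_ k) S].
Proof.
case/andP => s0 sk us ss; have k0 : 0 < k by lia.
pose f x : C_ k := insubd (Ordinal k0) (index x s).
have fE x : x \in s -> val (f x) = index x s.
  by move=> xs; rewrite val_insubd ifT // (leq_trans _ sk) ?index_mem.
pose K := cycle_segment k (size s).
have fI : {in [set x in s] &, injective f}.
  move=> x y; rewrite !inE => xs ys /(congr1 val); rewrite !fE // => e.
  by rewrite -(nth_index x xs) e nth_index.
exists ([set x in s],
  [set A : {set G} | (A \subset [set x in s]) && (f @: A \in K.2)]).
split=> //.
  move=> A /[!inE] /andP[/subsetP As /cycle_segment_edge [i [j [jm ji fA]]]].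
  have /imsetP[x xA ix] : i \in f @: A by rewrite fA set21.
  have /imsetP[y yA jy] : j \in f @: A by rewrite fA set22.
  have xs := As x xA; have ys := As y yA.
  exists x, y; split=> //.
    move: ji; rewrite ix jy !inE /= in xs ys *; rewrite !fE // => yx.
    have := ss; case: (s) => [//|z t] in xs ys yx *.
    move/(pathP x)/(_ (index x (z :: t))) => xy.
    have : index y (z :: t) < size (z :: t) by rewrite index_mem.
    rewrite yx ltnS => /xy; rewrite nth_index // => xt.
    by rewrite -(nth_index x ys) yx.
  apply/eqP; rewrite eqEsubset subUset !sub1set xA yA !andbT.
  apply/subsetP => z zA.
  have : f z \in f @: A by apply: imset_f.
  rewrite fA !inE ix jy => /orP[]/eqP/fI ->; rewrite ?eqxx ?orbT //;
  exact: As.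
exists K; split; first exact: cycle_segment_subgraph.
  exact: cycle_segment_connected.
exists f; split=> //=.
  apply/setP => i; apply/imsetP/idP => [[x /[!inE] xs ->]|].
    by rewrite /= fE // index_mem.
  rewrite inE => im; have [x0 _] : exists x0 : G, x0 \in s.
    by case: (s) s0 => [//|x0 t] _; exists x0; rewrite mem_head.
  exists (nth x0 s i); first by rewrite inE mem_nth.
  by apply: val_inj; rewrite /= fE ?mem_nth // index_uniq.
move=> x y xs ys; rewrite inE subUset !sub1set xs ys /=.
by rewrite imsetU1 imset_set1.
Qed.

Lemma path_cover (G : sgraph) k m (s : seq G) : 0 < k ->
  size s <= m * k -> uniq s -> sorted (@adj G) s ->
  exists F : {set subgraph G},
    [/\ #|F| <= m, \bigcup_(S in F) S.1 = [set x in s] &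
        forall S, S \in F -> is_subgraph S /\ copy_in (C_ k) S].
Proof.
move=> k0; elim: m s => [|m IH] s sm us ss; have [s0|s0] := posnP (size s).
1,3: exists set0; split=> [||S];
     rewrite ?cards0 ?big_set0 ?(size0nil s0) ?inE //;
     by apply/setP => x; rewrite !inE.
- by rewrite mul0n leqNgt s0 in sm.
have [|S [S1 sS cS]] :=
  @path_copy G k (take k s) _ (take_uniq k us) (take_sorted _ ss).
  by rewrite size_take; case: ifP; lia.
have [||F [Fm FU FP]] := IH (drop k s) _ (drop_uniq k us) _.
- by rewrite size_drop; lia.
- exact: drop_sorted.
exists (S |: F); split.
- by rewrite cardsU1; lia.
- rewrite bigcup_setU big_set1 FU S1; apply/setP => x.
  by rewrite !inE -mem_cat cat_take_drop.
- by move=> T /setU1P[-> //|]; apply: FP.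
Qed.

Lemma clique_sorted (G : sgraph) (s : seq G) :
  uniq s -> {in s &, forall y z, y != z -> adj y z} -> sorted (@adj G) s.
Proof.
case: s => [//|x s]; elim: s x => [//|y s IH] x /andP[xs us] cl /=.
rewrite cl ?inE ?eqxx ?orbT //=; last first.
  by apply: contraNneq xs => ->; rewrite mem_head.
by apply: IH => // z t zs ts; apply: cl; rewrite inE ?zs ?ts orbT.
Qed.

(** * Cuts of the BCDC network *)

Lemma isolated_disconnected (G : sgraph) (U : {set G}) p q :
  p \notin U -> q \notin U -> p != q -> (forall r, adj p r -> r \in U) ->
  sg_disconnected (induced (~: U)).
Proof.
move=> pU qU pq pN; exists p, q; rewrite !inE; split=> //.
apply/connectP => -[[|r t] /=]; first by move=> _ e; rewrite e eqxx in pq.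
by rewrite induced_edge !inE => /andP[/and3P[_ /negP rU /pN]].
Qed.

Lemma arcs_cut n (X : {set CQ n}) : exists P : pred (seq bool),
  [/\ #|arcs X| = cut n P, #|X| = weight n P & #|~: X| = weight n (predC P)].
Proof.
pose P s := oapp (fun t : n.-tuple bool => t \in X) false (insub s).
have PE (t : n.-tuple bool) : P t = (t \in X) by rewrite /P valK.
exists P; split.
- rewrite /cut pair_big -sum1_card big_mkcond /=.
  by apply: eq_bigr => -[s t] _; rewrite inE !PE /= andbA; case: ifP.
- rewrite -sum1_card big_mkcond; apply: eq_bigr => t _.
  by rewrite PE; case: ifP.
- rewrite -sum1_card big_mkcond; apply: eq_bigr => t _.
  by rewrite inE /= PE; case: ifP.
Qed.

Lemma cq_arcs_ge n (X : {set CQ n}) :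
  1 < #|X| -> 1 < #|~: X| -> 2 * n - 2 <= #|arcs X|.
Proof. by have [P [-> -> ->]] := arcs_cut X; apply: cut_ge_edge_degree. Qed.

Lemma cq_arcs_gt n (X : {set CQ n}) : 3 < n ->
  2 < #|X| -> 2 < #|~: X| -> 2 * n - 2 < #|arcs X|.
Proof. by have [P [-> -> ->]] := arcs_cut X; apply: cut_gt_edge_degree. Qed.

Lemma card_cq_star n (a : CQ n) : 1 < n -> #|star (@bcdc_ends n) a| = n.
Proof.
move=> n1; rewrite (card_star (bcdc_line_graph n1)) -[RHS](cq_degree a).
rewrite -sum1_card big_mkcond; apply: eq_bigr => t _.
by rewrite inE -[cq_adj n a t]/(adj a t); case: ifP.
Qed.

Lemma cq_no_triangle n (x y z : CQ n) : adj x y -> adj x z -> adj y z -> False.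
Proof.
exact: (cq_triangle_free (size_tuple x) (size_tuple y) (size_tuple z)).
Qed.

(** The square [a b y x] and the edge [c d] differ in the leading bit; all
    middle bits are 0, so adjacency reduces to that of the last two bits. *)
Lemma cq_square n : 2 < n -> exists a b x y c d : CQ n,
  [/\ adj a b, [/\ adj a x, adj b y & adj x y], adj c d &
      uniq [:: a; b; x; y; c; d]].
Proof.
case: n => [|[|[|m]]] // _.
have sz (e u v : bool) : size (e :: nseq m false ++ [:: u; v]) == m.+3.
  by rewrite /= size_cat size_nseq addn2.
pose w e u v : CQ m.+3 := Tuple (sz e u v).
have wE e u v e' u' v' :
    (w e u v == w e' u' v') = [&& e == e', u == u' & v == v'].
  by rewrite -val_eqE /= eqseq_cons eqseq_cat // eqxx /= !eqseq_cons andbT.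
have adjE e u v u' v' :
    adj (w e u v) (w e u' v') = cq_adj 2 [:: u; v] [:: u'; v'].
  rewrite /adj /= /cq_rel -/(cq_adj m.+3 _ _).
  rewrite cq_adj_cons ?eqxx ?size_cat ?size_nseq ?addn2 //.
  elim: m {sz w wE} => [//|m IH].
  by rewrite [nseq _ _ ++ _]/= [X in cq_adj _ _ X]/= cq_adj_cons ?eqxx //;
     rewrite size_cat size_nseq addn2.
exists (w false false false), (w false false true), (w false true false),
  (w false true true), (w true false false), (w true false true).
by rewrite !adjE; split=> //; rewrite /= !inE !wE.
Qed.

(** A trivial remainder cannot occur with so few deletions: the boundary of an
    edge [ab], that edge and another edge [cd] disjoint from it are already [2n]
    vertices of [B_ n]. *)
Lemma bcdc_cut_card n (U : {set B_ n}) : 3 < n ->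
  sg_disconnected (induced (~: U)) \/ sg_trivial (induced (~: U)) ->
  2 * n - 2 <= #|U| /\ (#|U| = 2 * n - 2 -> exists p, U = nbr p).
Proof.
move=> n3; have LG := @bcdc_line_graph n (ltn_trans (isT : 1 < 3) n3).
case=> [|W1].
  apply: (disconnected_card LG) => X; first exact: cq_arcs_ge.
  exact: cq_arcs_gt.
suff lt : 2 * n - 2 < #|U|.
  by split=> [|e]; [exact: ltnW | rewrite e ltnn in lt].
have {}W1 : #|~: U| = 1 := W1.
have : 2 * n <= #|B_ n|; last by rewrite -(cardsC U) W1; lia.
have [a [b [x [y [c [d [ab _ cd]]]]]]] := cq_square (ltnW n3).
rewrite /= !inE !negb_or .
case/and5P=> /and5P[nab _ _ ac ad] /and4P[_ _ bc bd] _ _ /andP[ncd _].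
have [p ep] := edge_ends LG ab; have [q eq] := edge_ends LG cd.
have D : 2 * n - 2 <= #|boundary (@bcdc_ends n) [set a; b]|.
  apply: leq_trans (card_boundary LG _); apply: cq_arcs_ge.
    by rewrite cards2 nab.
  have <- : #|[set c; d]| = 2 by rewrite cards2 ncd.
  apply/subset_leq_card; rewrite subUset !sub1set !inE.
  by rewrite !(eq_sym c) !(eq_sym d) !negb_or ac ad bc bd.
pose E := p |: (q |: boundary (@bcdc_ends n) [set a; b]).
apply: leq_trans (max_card (mem E)); rewrite /E.
rewrite !cardsU1 !inE ep eq subxx andbF orbF.
have -> : p != q.
  apply: contraNneq ac => pq; move: ep; rewrite pq eq.
  case/eq_set2 => [[-> _]|[cb _]] //.
  by rewrite cb eqxx in bc.
have -> : [disjoint [set c; d] & [set a; b]].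
  rewrite -setI_eq0; apply/eqP/setP => z; rewrite !inE.
  apply/negbTE/negP => /andP[/orP[]/eqP -> /orP[]/eqP e].
  - by rewrite e eqxx in ac.
  - by rewrite e eqxx in bc.
  - by rewrite e eqxx in ad.
  - by rewrite e eqxx in bd.
lia.
Qed.

Lemma card_cover_le (T I : finType) (F : {set I}) (V : I -> {set T}) k :
  (forall S, S \in F -> #|V S| <= k) -> #|\bigcup_(S in F) V S| <= #|F| * k.
Proof.
move=> Vk; rewrite -sum_nat_const.
elim/big_rec2: _ => [|S m A SF IH]; first by rewrite cards0.
by apply: leq_trans (leq_card_setU _ _) _; apply: leq_add (Vk S SF) IH.
Qed.

(** Any member of the cover that meets A lies inside A. *)
Lemma card_side_le (T I : finType) (F : {set I}) (V : I -> {set T})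
    (A B : {set T}) k :
  [disjoint A & B] -> A \subset \bigcup_(S in F) V S ->
  (forall S, S \in F -> V S \subset A \/ V S \subset B) ->
  (forall S, S \in F -> #|V S| <= k) ->
  #|A| <= #|[set S in F | (V S \subset A) && (V S != set0)]| * k.
Proof.
move=> dAB AV VAB Vk; set FA := [set S in F | _].
apply: (@leq_trans #|\bigcup_(S in FA) V S|); last first.
  by apply: card_cover_le => S; rewrite inE => /andP[/Vk].
apply/subset_leq_card/subsetP => q qA.
have /bigcupP[S SF qS] := subsetP AV q qA; apply/bigcupP; exists S => //.
rewrite inE SF /=; apply/andP; split; last by apply/set0Pn; exists q.
have [//|/subsetP/(_ q qS)] := VAB S SF.
by rewrite (disjointFr dAB qA).
Qed.

(** The members inside A and those inside B are different, so the two bounds of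
    [card_side_le] add up to at most [#|F| * k] and must both be equalities. *)
Lemma tight_cover_dvdn (T I : finType) (F : {set I}) (V : I -> {set T})
    (A B : {set T}) k :
  [disjoint A & B] -> A :|: B \subset \bigcup_(S in F) V S ->
  (forall S, S \in F -> V S \subset A \/ V S \subset B) ->
  (forall S, S \in F -> #|V S| <= k) ->
  #|A| + #|B| = #|F| * k -> k %| #|A|.
Proof.
move=> dAB; rewrite subUset => /andP[AV BV] VAB Vk Fk.
have lA := card_side_le dAB AV VAB Vk; rewrite disjoint_sym in dAB.
have VBA S : S \in F -> V S \subset B \/ V S \subset A.
  by case/VAB; [right|left].
have lB := card_side_le dAB BV VBA Vk; move: lA lB.
set FA := [set S in F | _]; set FB := [set S in F | _] => lA lB.
have FAB : #|FA| + #|FB| <= #|F|.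
  have <- : #|FA :|: FB| = #|FA| + #|FB|.
    rewrite cardsU; have -> : FA :&: FB = set0; last by rewrite cards0 subn0.
    apply/setP => S; rewrite !inE; apply/negbTE/negP.
    case/andP => /and3P[_ /subsetP SA /set0Pn[q qS]] /and3P[_ /subsetP SB _].
    by have := SA q qS; rewrite (disjointFr dAB (SB q qS)).
  by apply/subset_leq_card/subsetP => S; rewrite !inE => /orP[]/andP[].
apply/dvdnP; exists #|FA|; have := leq_mul FAB (leqnn k); lia.
Qed.

(** In the equality case the cut is a neighbourhood covered with no slack, so
    the stars at the two ends, each of [n-1] vertices, are split evenly. *)
Lemma substructure_cut_lower n k (F : {set subgraph (B_ n)}) : 3 < n ->
  substructure_cut (C_ k) F ->
  2 * n - 2 <= #|F| * k /\ (#|F| * k = 2 * n - 2 -> k %| n - 1).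
Proof.
move=> n3 [[sF cF] HF]; have n1 := ltn_trans (isT : 1 < 3) n3.
have LG := @bcdc_line_graph n n1.
have Fk S : S \in F -> #|S.1| <= k.
  by move=> /HF /copy_card; rewrite card_ord.
have [lo eqN] := bcdc_cut_card n3 cF.
have up := card_cover_le Fk.
split=> [|Fe]; first exact: leq_trans up.
have [|p Up] := eqN; first by apply/eqP; rewrite eqn_leq lo -Fe up.
have [a [b [ab ep]]] := ends_edge LG p.
set A := star (@bcdc_ends n) a :\ p; set B := star (@bcdc_ends n) b :\ p.
have UE := nbr_star LG ep; rewrite -/A -/B in UE.
have card_side c : p \in star (@bcdc_ends n) c ->
    #|star (@bcdc_ends n) c :\ p| = n - 1.
  by move=> /card_star_del ->; rewrite card_cq_star.
have cA : #|A| = n - 1 by apply: card_side; rewrite inE ep set21.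
have cB : #|B| = n - 1 by apply: card_side; rewrite inE ep set22.
have dAB : [disjoint A & B].
  rewrite -setI_eq0; apply/eqP/setP => q; rewrite in_setI !in_setD1 in_set0.
  apply/negbTE/negP => /andP[/andP[qp qa] /andP[_ qb]].
  by case/eqP: qp; apply: (star_pair LG ep).
have nAB : {in A & B, forall q r, ~~ adj q r}.
  move=> q r; apply: stars_nonadjacent LG _ _ _ _ _ _ ep.
  exact: cq_no_triangle.
rewrite -cA; apply: (tight_cover_dvdn (F := F) (V := fun S => S.1) dAB) => //.
- by rewrite -UE -Up.
- move=> S SF; apply: copy_side (sF S SF) (HF S SF) _ nAB.
  by rewrite -UE -Up; apply: bigcup_sup.
- by rewrite cA cB Fe; lia.
Qed.


(** With p the edge [ab], the path runs through the other edges at a, ending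
    with [ax], passes over [xy], and runs through the other edges at b from [by]
    on. The edge [cd] misses the path, so removing the path isolates p without
    leaving it alone. *)
Lemma line_graph_paths (G L : sgraph) (ends : L -> {set G}) n
    (a b x y c d : G) :
  line_graph ends -> (forall z, #|star ends z| = n) ->
  adj a b -> adj a x -> adj b y -> adj x y -> adj c d ->
  uniq [:: a; b; x; y; c; d] ->
  exists (p q : L) (A B : {set L}) (s : seq L),
  [/\ nbr p = A :|: B, #|A| = n - 1 /\ #|B| = n - 1,
      {in A &, forall x y, x != y -> adj x y} /\
      {in B &, forall x y, x != y -> adj x y},
      [/\ uniq s, sorted (@adj L) s, size s = 2 * n - 1 &
          A :|: B \subset s] &
      [/\ p \notin s, q \notin s & p != q]].
Proof.
move=> LG reg ab ax by_ xy cd.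
rewrite /= !inE !negb_or.
case/and5P=> /and5P[nab nax nay nac nad] /and4P[nbx nby nbc nbd].
case/and3P=> nxy nxc nxd /andP[nyc nyd] /andP[ncd _].
have [p ep] := edge_ends LG ab; have [u eu] := edge_ends LG ax.
have [v ev] := edge_ends LG by_; have [w ew] := edge_ends LG xy.
have [q eq] := edge_ends LG cd.
set A := star ends a :\ p; set B := star ends b :\ p.
have neq r r' z : ends r = r' -> z \in r' -> z \notin ends p -> r != p.
  by move=> <- zr; apply: contraNneq => <-.
have uA : u \in A.
  rewrite !inE eu set21 andbT (neq _ _ _ eu (set22 a x)) //.
  by rewrite ep !inE negb_or eq_sym nax eq_sym nbx.
have vB : v \in B.
  rewrite !inE ev set21 andbT (neq _ _ _ ev (set22 b y)) //.
  by rewrite ep !inE negb_or eq_sym nay eq_sym nby.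
have card_side z : p \in star ends z ->
    #|star ends z :\ p| = n - 1.
  by move=> /card_star_del ->; rewrite reg.
have cA : #|A| = n - 1 by apply: card_side; rewrite inE ep set21.
have cB : #|B| = n - 1 by apply: card_side; rewrite inE ep set22.
have dAB : A :&: B = set0.
  apply/setP => r; rewrite in_setI !in_setD1 in_set0.
  apply/negbTE/negP => /andP[/andP[rp ra] /andP[_ rb]].
  by case/eqP: rp; apply: (star_pair LG ep).
have clA : {in A &, forall x y, x != y -> adj x y}.
  move=> r r'; rewrite !in_setD1 => /andP[_ ra] /andP[_ ra'].
  exact: (star_clique LG ra ra').
have clB : {in B &, forall x y, x != y -> adj x y}.
  move=> r r'; rewrite !in_setD1 => /andP[_ ra] /andP[_ ra'].
  exact: (star_clique LG ra ra').
have wAB : w \notin A :|: B.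
  by rewrite !inE ew !inE (negPf nax) (negPf nay) (negPf nbx) (negPf nby)
    !andbF.
have qAB : q \notin A :|: B.
  by rewrite !inE eq !inE (negPf nac) (negPf nad) (negPf nbc) (negPf nbd)
    !andbF.
have pAB : p \notin A :|: B by rewrite !inE eqxx.
(* u = ax and v = by are the ends of the two cliques that w = xy links. *)
pose s := enum (A :\ u) ++ u :: w :: v :: enum (B :\ v).
have sE : s =i w |: (A :|: B).
  move=> r; rewrite mem_cat !inE !mem_enum !inE.
  case: (eqVneq r u) => [->|_].
    by move: uA; rewrite !inE => ->; rewrite !orbT.
  case: (eqVneq r v) => [->|_].
    by move: vB; rewrite !inE => ->; rewrite !orbT.
  by case: (r == w); rewrite ?orbT.
have ss : size s = 2 * n - 1.
  rewrite size_cat /= -!cardE.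
  move: (cardsD1 u A) (cardsD1 v B); rewrite uA vB cA cB.
  by clear; lia.
have n1 : 0 < n - 1 by rewrite -cA; apply/card_gt0P; exists u.
exists p, q, A, B, s; split=> //.
- exact: (nbr_star LG ep).
- split=> //.
  + apply/card_uniqP; rewrite (eq_card sE) ss cardsU1 wAB.
    rewrite cardsU dAB cards0 cA cB.
    by move: n1; clear; lia.
  + rewrite sorted_cat_cons /=; apply/and4P; split.
    * apply: clique_sorted.
        by rewrite rcons_uniq mem_enum !inE eqxx enum_uniq.
      move=> r r'; rewrite !mem_rcons !inE !mem_enum => ur ur'; apply: clA.
        by case/orP: ur => [/eqP->//|]; rewrite inE => /andP[].
      by case/orP: ur' => [/eqP->//|]; rewrite inE => /andP[].
    * apply: (star_clique LG (a := x)); rewrite ?inE ?eu ?ew ?set21 ?set22 //.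
      by apply: contraNneq wAB => <-; rewrite inE uA.
    * apply: (star_clique LG (a := y)); rewrite ?inE ?ev ?ew ?set21 ?set22 //.
      by apply: contraNneq wAB => ->; rewrite inE vB orbT.
    * apply: (@clique_sorted _ (v :: _)).
        by rewrite /= mem_enum !inE eqxx enum_uniq.
      move=> r r'; rewrite !inE !mem_enum => ur ur'; apply: clB.
        by case/orP: ur => [/eqP->//|]; rewrite inE => /andP[].
      by case/orP: ur' => [/eqP->//|]; rewrite inE => /andP[].
  + by apply/subsetP => r rAB; rewrite sE inE rAB orbT.
- rewrite !sE !in_setU1 (negPf pAB) (negPf qAB) !orbF; split.
  + rewrite eq_sym (neq _ _ _ ew (set21 x y)) //.
    by rewrite ep !inE negb_or eq_sym nax eq_sym nbx.
  + rewrite -(inj_eq (ends_inj LG)) eq ew; apply/eqP => /eq_set2 [[e _]|[e _]].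
      by rewrite e eqxx in nxc.
    by rewrite e eqxx in nyc.
  + rewrite eq_sym (neq _ _ _ eq (set21 c d)) //.
    by rewrite ep !inE negb_or eq_sym nac eq_sym nbc.
Qed.

Lemma isolating_cut (G H : sgraph) (F : {set subgraph G}) (p q : G) :
  (forall S, S \in F -> is_subgraph S /\ copy_in H S) ->
  nbr p \subset \bigcup_(S in F) S.1 ->
  p \notin \bigcup_(S in F) S.1 -> q \notin \bigcup_(S in F) S.1 -> p != q ->
  substructure_cut H F.
Proof.
move=> FP /subsetP pN pF qF pq; split=> [|S /FP[]//].
split=> [S /FP[]//|]; left; apply: (isolated_disconnected pF qF pq) => r pr.
by apply: pN; rewrite inE.
Qed.

Theorem theorem4p12 (n k : nat) (hn : 4 <= n) (hk : 4 <= k <= 2 * n - 1) :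
  kappa_s_eq (B_ n) (C_ k)
    (if (4 <= k <= n - 1) && (k %| n - 1)
     then (2 * n - 2) %/ k
     else ceil_divn (2 * n - 1) k).
Proof.
have k0 : 0 < k by lia.
set m := (if _ then _ else _).
have lower (F : {set subgraph (B_ n)}) : substructure_cut (C_ k) F -> m <= #|F|.
  move=> cF; have [Fk Fdvd] := substructure_cut_lower hn cF; rewrite /m.
  case: ifP => [_|/negbT ndvd].
    by apply: leq_trans (leq_div2r k Fk) _; rewrite mulnK.
  rewrite ceil_divn_leq // leqNgt; apply: contra ndvd => lt.
  have kn : k %| n - 1 by apply: Fdvd; lia.
  have n1 : 0 < n - 1 by lia.
  by rewrite kn (dvdn_leq n1 kn) andbT; lia.
(* By the lower bound, a cut with at most m members has exactly m. *)
suff [F cF Fm] :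
  exists2 F : {set subgraph (B_ n)}, substructure_cut (C_ k) F & #|F| <= m.
  by split=> //; exists F => //; apply/eqP; rewrite eqn_leq Fm lower.
have n1 := ltn_trans (isT : 1 < 3) hn.
have [a [b [x [y [c [d [ab [ax by_ xy] cd abc]]]]]]] := cq_square (ltnW hn).
have reg (z : CQ n) := card_cq_star z n1.
have [p [q [A [B [s]]]]] :=
  line_graph_paths (bcdc_line_graph n1) reg ab ax by_ xy cd abc.
case=> pN [cA cB] [clA clB] [us ss szs ABs] [ps qs pq].
rewrite /m; case: ifP => [/andP[_ kn]|_]; last first.
  have sk : size s <= ceil_divn (2 * n - 1) k * k by rewrite szs -ceil_divn_leq.
  have [F [Fm FU FP]] := path_cover k0 sk us ss.
  exists F => //; apply: isolating_cut FP _ _ _ pq; rewrite ?FU ?inE ?pN //.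
  by apply: subset_trans ABs _; apply/subsetP => r; rewrite inE.
have cover (X : {set B_ n}) : #|X| = n - 1 ->
  {in X &, forall x y, x != y -> adj x y} ->
  exists F : {set subgraph (B_ n)},
    [/\ #|F| <= (n - 1) %/ k, \bigcup_(S in F) S.1 = X &
        forall S, S \in F -> is_subgraph S /\ copy_in (C_ k) S].
  move=> cX clX.
  have sX : size (enum X) <= (n - 1) %/ k * k by rewrite -cardE cX divnK.
  have clE : {in enum X &, forall x y, x != y -> adj x y}.
    by move=> r t; rewrite !mem_enum; apply: clX.
  have [F [Fm FU FP]] :=
    path_cover k0 sX (enum_uniq X) (clique_sorted (enum_uniq X) clE).
  by exists F; split=> //; rewrite FU; apply/setP => r; rewrite inE mem_enum.
have [FA [Am AU AP]] := cover A cA clA.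
have [FB [Bm BU BP]] := cover B cB clB.
have UE : \bigcup_(S in FA :|: FB) S.1 = A :|: B by rewrite bigcup_setU AU BU.
have ABs' r : r \notin s -> r \notin A :|: B.
  by apply: contra => /(subsetP ABs).
exists (FA :|: FB).
  apply: isolating_cut _ _ _ _ pq; rewrite ?UE ?pN ?ABs' //.
  by move=> S /setUP[/AP|/BP].
apply: leq_trans (leq_card_setU _ _) _.
have -> : 2 * n - 2 = (n - 1) + (n - 1) by clear; lia.
by rewrite divnDl // leq_add.
Qed.
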